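(* Let $d\ge1$, $n\ge1$, and let $\{\boldsymbol{x}_i\}_{i=1}^n$ be an $n$-point jittered sampling point process on $\mathbb{S}^d$ associated with a partition $\{D_{i,n}\}_{i=1}^n$ and constant $c$ as described in the context, with analysis matrix $X_n$. Then \[ \mathbb{E}\Big(\Big\|\frac1nX_n^TX_n-\frac1{d+1}\mathcal{I}_{d+1}\Big\|_{\mathcal F}^2\Big)\le\frac1n-\frac1n\left(1-\frac{c^2}{2n^{2/d}}\right)^2. \]
   Context: $\mathbb{S}^d=\{\boldsymbol{x}\in\mathbb{R}^{d+1}:\|\boldsymbol{x}\|=1\}$, $\sigma_d$ normalized surface measure, $\mathrm{diam}\,A=\sup\{\|\boldsymbol{x}-\boldsymbol{y}\|:\boldsymbol{x},\boldsymbol{y}\in A\}$. Analysis matrix: the $n\times(d+1)$ matrix $X_n$ with rows $\boldsymbol{x}_i^T$; $\mathcal{I}_{d+1}$ identity, $\|\cdot\|_{\mathcal F}$ Frobenius norm. Jittered sampling point process: $\{D_{i,n}\}_{i=1}^n$ is a partition of $\mathbb{S}^d$ with $\bigcup_jD_{j,n}=\mathbb{S}^d$, $\sigma_d(D_{j,n}\cap D_{k,n})=0$ for $j\neq k$, $\sigma_d(D_{j,n})=1/n$, and $\mathrm{diam}\,D_{j,n}\le c/n^{1/d}<\sqrt2$ for all $j$, with $c$ a constant independent of $n$; independently for each $i$, $\boldsymbol{x}_i$ is chosen uniformly at random from $D_{i,n}$ (w.r.t. $\sigma_d$ restricted to $D_{i,n}$ and normalized). *)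

(* Defs.v *)
From HB Require Import structures.
From mathcomp Require Import all_boot all_order all_algebra.
From mathcomp Require Import all_classical all_reals all_analysis.

Set Implicit Arguments.
Unset Strict Implicit.
Unset Printing Implicit Defensive.

Import Order.TTheory GRing.Theory Num.Theory.
Import numFieldNormedType.Exports.

Local Open Scope classical_set_scope.
Local Open Scope ring_scope.

Section Defs.
Variable R : realType.

(* Points of R^k are k-tuples of reals; they carry MathComp-Analysis'
   product (Borel) sigma-algebra on tuples. *)

Definition enorm k (x : k.-tuple R) : R :=
  Num.sqrt (\sum_(j < k) (tnth x j) ^+ 2).

Definition eucl_dist k (x y : k.-tuple R) : R :=
  Num.sqrt (\sum_(j < k) (tnth x j - tnth y j) ^+ 2).

Definition sphere d : set (d.+1.-tuple R) := [set x | enorm x = 1].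

Definition normalize k (x : k.-tuple R) : k.-tuple R :=
  map_tuple (fun a => a / enorm x) x.

(** Iterated Lebesgue integral of a nonnegative function on R^k
    (= integral w.r.t. k-dimensional Lebesgue measure, by Tonelli). *)
Fixpoint lebint (k : nat) : (k.-tuple R -> \bar R) -> \bar R :=
  match k with
  | 0 => fun f => f [tuple]
  | k'.+1 => fun f =>
      (\int[@lebesgue_measure R]_(t in setT)
         lebint (fun v : k'.-tuple R => f (cons_tuple t v)))%E
  end.

Definition ball_vol k : R :=
  fine (lebint (fun x : k.-tuple R => (if enorm x <= 1 then 1 else 0)%:E)).

(** Integral against the normalized surface measure sigma_d on S^d, defined
    as the (normalized) cone measure:
      int f dsigma_d = (1/|B|) int_{0 < |x| <= 1} f(x/|x|) dx. *)
Definition sphere_int d (f : d.+1.-tuple R -> \bar R) : \bar R :=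
  (lebint (fun x : d.+1.-tuple R =>
             if ((0 < enorm x) && (enorm x <= 1))%R then f (normalize x) else 0%E)
   * ((ball_vol d.+1)^-1)%:E)%E.

Definition sphere_meas d (A : set (d.+1.-tuple R)) : \bar R :=
  sphere_int (fun x => (\1_A x)%:E).

(** Expectation for independent points x_1,...,x_k, x_i uniformly
    distributed on D_i w.r.t. sigma_d restricted to D_i and normalized:
    iterated integral against the product of these laws (Tonelli). *)
Fixpoint jitter_exp d (Ds : seq (set (d.+1.-tuple R)))
    (F : seq (d.+1.-tuple R) -> \bar R) : \bar R :=
  match Ds with
  | [::] => F [::]
  | D :: Ds' =>
      (sphere_int (fun x => (\1_D x)%:E *
                     jitter_exp Ds' (fun s => F (x :: s)))
       * ((fine (sphere_meas D))^-1)%:E)%E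
  end.

Definition analysis_matrix d n (xs : seq (d.+1.-tuple R)) : 'M[R]_(n, d.+1) :=
  \matrix_(i < n, j < d.+1) tnth (nth [tuple of nseq d.+1 0] xs i) j.

Definition frob2 m p (A : 'M[R]_(m, p)) : R :=
  \sum_(i < m) \sum_(j < p) (A i j) ^+ 2.

End Defs.

Arguments sphere {R} d.
Arguments analysis_matrix {R} d n xs.

(* Main.v *)
Require Import Defs.
From HB Require Import structures.
From mathcomp Require Import all_boot all_order all_algebra.
From mathcomp Require Import all_classical all_reals all_analysis.
From mathcomp Require Import perm measurable_realfun ring lra.
Import Order.TTheory GRing.Theory Num.Theory.
Local Open Scope classical_set_scope.
Local Open Scope ring_scope.

(* Let x_1, ..., x_n be the sampled points, w = 1/n, and let M_i be the mean of
   the rank-one matrix x x^T for x uniform in D_i. Independence gives the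
   bias-variance identity
     E |w sum_i x_i x_i^T + A|^2
       = |w sum_i M_i + A|^2 + w^2 sum_i (1 - |M_i|^2)
   for the Frobenius norm, because |x x^T| = 1 on the sphere; it is proved one
   point at a time. Since the cells have equal mass and cover the sphere up to
   null overlaps, w sum_i M_i is the second moment of the whole sphere, which
   is I / (d+1): reflecting one coordinate kills the off-diagonal entries and
   exchanging two coordinates makes the diagonal entries equal. So the bias
   vanishes for A = - I / (d+1). Finally |M_i|^2 is the mean of <x, y>^2 over
   D_i x D_i, and <x, y> = 1 - |x - y|^2 / 2 is bounded below by the diameter
   bound. *)

Set Implicit Arguments.
Unset Strict Implicit.

(** * Invariance of the iterated Lebesgue integral *)

Section iterated_integral.
Context {R : realType}.

Lemma lebint_ge0 k (f : k.-tuple R -> \bar R) :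
  (forall x, 0 <= f x)%E -> (0 <= lebint f)%E.
Proof.
elim: k f => [|k IH] f f0 /=; first exact: f0.
by apply: integral_ge0 => t _; apply: IH => v; exact: f0.
Qed.

Lemma measurable_cons_tuple d (T : measurableType d) k (g : T -> R)
    (h : T -> k.-tuple R) :
  measurable_fun [set: T] g -> measurable_fun [set: T] h ->
  measurable_fun [set: T] (fun x => cons_tuple (g x) (h x) : k.+1.-tuple R).
Proof. exact: measurable_cons. Qed.

Lemma measurable_cons_pair k :
  measurable_fun [set: measurableTypeR R * k.-tuple R]
    (fun p => cons_tuple p.1 p.2 : k.+1.-tuple R).
Proof. exact: measurable_cons_tuple measurable_fst measurable_snd. Qed.

Lemma measurable_cons_fun k (f : k.+1.-tuple R -> \bar R) (t : R) :
  measurable_fun [set: k.+1.-tuple R] f ->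
  measurable_fun [set: k.-tuple R] (fun v => f (cons_tuple t v)).
Proof.
move=> mf; apply: (measurableT_comp (f := f) (g := cons_tuple t) mf).
by apply: (@measurable_cons_tuple _ _ _ (fun=> t : R) id); first
  exact: measurable_cst.
Qed.

(* Sigma-finiteness of [m1 \x m2] is proved here because the canonical instance
   found for a product is the one for products of subprobabilities. *)
Lemma product_measure_transport d1 d2 d' (T1 : measurableType d1)
    (T2 : measurableType d2) (T' : measurableType d')
    (m1 : {sigma_finite_measure set T1 -> \bar R})
    (m2 : {sigma_finite_measure set T2 -> \bar R})
    (phi : T1 * T2 -> T') (psi : T' -> T1 * T2) :
  measurable_fun setT phi -> measurable_fun setT psi -> cancel phi psi ->
  exists m' : {sigma_finite_measure set T' -> \bar R},
    forall f : T' -> \bar R, measurable_fun [set: T'] f ->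
      (forall x, 0 <= f x)%E ->
    (\int[m']_x f x = \int[m1]_x \int[m2]_y f (phi (x, y)))%E.
Proof.
move=> mphi mpsi phiK.
pose push : {measure set T' -> \bar R} :=
  measure_function_pushforward__canonical__measure_function_Measure
    (m1 \x m2)%E mphi.
have sfin : sigma_finite setT push.
  have /sigma_finiteP[F [FT ndF Foo]] := sigma_finiteT m1.
  have /sigma_finiteP[G [GT ndG Goo]] := sigma_finiteT m2.
  (* As [psi] inverts [phi] on the left, the pushforward gives each of these preimages the mass of
     the box it comes from. *)
  exists (fun n => psi @^-1` (F n `*` G n)).
    apply/esym; rewrite -subTset => z _.
    have [i _ Fi] : (\bigcup_n F n) (psi z).1 by rewrite -FT.
    have [j _ Gj] : (\bigcup_n G n) (psi z).2 by rewrite -GT.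
    exists (maxn i j) => //; split.
      by move: Fi; apply/subsetPset/ndF/leq_maxl.
    by move: Gj; apply/subsetPset/ndG/leq_maxr.
  move=> n; have [mF Fn] := Foo n; have [mG Gn] := Goo n; split.
    by rewrite -[X in measurable X]setTI; apply: mpsi => //; exact: measurableX.
  rewrite [X in (X < _)%E](_ : _ = (m1 \x m2)%E (F n `*` G n)).
    by rewrite product_measure1E// lte_mul_pinfty// ge0_fin_numE.
  by congr ((m1 \x m2)%E _); apply/seteqP; split=> x /=; rewrite phiK.
pose pushS : {sigma_finite_measure set T' -> \bar R} :=
  HB.pack (push : set T' -> \bar R) (Measure.on push)
    (Measure_isSigmaFinite.Build _ _ _ push sfin).
exists pushS => f mf f0.
rewrite [LHS](@ge0_integral_pushforward _ _ _ _ _ _ mphi (m1 \x m2)%E)//.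
rewrite preimage_setT (@fubini_tonelli1 _ _ _ _ _ m1 m2 (f \o phi))//.
- exact: measurableT_comp mf mphi.
- by move=> x; exact: f0.
Qed.

(** Opens the way to Tonelli for [lebint]: in dimension 0 the measure is the Dirac mass at the empty
    tuple, and each further dimension is the image under consing of the product with Lebesgue
    measure. *)
Lemma lebint_measureP k :
  exists m : {sigma_finite_measure set (k.-tuple R) -> \bar R},
  forall f : k.-tuple R -> \bar R, measurable_fun [set: k.-tuple R] f ->
    (forall x, 0 <= f x)%E -> lebint f = (\int[m]_x f x)%E.
Proof.
elim: k => [|k [m Hm]].
  exists (\d_([tuple] : 0.-tuple R)) => f mf f0 /=.
  by rewrite integral_dirac// diracT mul1e.
have mdecons : measurable_fun [set: k.+1.-tuple R]
    (fun x : k.+1.-tuple R => (thead x : measurableTypeR R, behead_tuple x)).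
  apply: measurable_fun_pair => /=; first exact: measurable_tnth.
  exact: measurable_behead.
have consK (p : measurableTypeR R * k.-tuple R) :
    (thead (cons_tuple p.1 p.2) : measurableTypeR R,
     behead_tuple (cons_tuple p.1 p.2)) = p.
  by case: p => t v; rewrite /= theadE; congr pair; exact: val_inj.
have [m' Hm'] := product_measure_transport (@lebesgue_measure R) m
  (@measurable_cons_pair k) mdecons consK.
exists m' => f mf f0; rewrite Hm'//=.
by apply: eq_integral => t _; apply: Hm => //; exact: measurable_cons_fun.
Qed.

(** The parameter space is arbitrary because it is used both for one outer coordinate and for a pair
    of them. *)
Lemma measurable_lebint k d (T : measurableType d) (f : T * k.-tuple R -> \bar R) :
  measurable_fun setT f -> (forall x, 0 <= f x)%E ->
  measurable_fun [set: T] (fun x => lebint (fun v => f (x, v))).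
Proof.
move=> mf f0; have [m Hm] := lebint_measureP k.
rewrite (_ : (fun x => _) = (fun x => \int[m]_v f (x, v))%E).
  exact: (@measurable_fun_fubini_tonelli_F _ _ _ _ _ m f).
apply/funext => x; apply: Hm => //.
apply: (measurableT_comp (f := f) (g := pair x) mf).
exact: measurable_fun_pair.
Qed.

Lemma measurable_lebint_cons k (f : k.+1.-tuple R -> \bar R) :
  measurable_fun [set: k.+1.-tuple R] f -> (forall x, 0 <= f x)%E ->
  measurable_fun [set: measurableTypeR R]
    (fun t => lebint (fun v => f (cons_tuple t v))).
Proof.
move=> mf f0.
apply: (@measurable_lebint k _ (measurableTypeR R)
  (fun p => f (cons_tuple p.1 p.2))) => //.
exact: measurableT_comp mf (@measurable_cons_pair k).
Qed.

(** * Reflections and permutations of coordinates *)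

Definition flip_coord k (i : 'I_k) (x : k.-tuple R) : k.-tuple R :=
  [tuple if j == i then - tnth x j else tnth x j | j < k].

Definition perm_coord k (s : 'S_k) (x : k.-tuple R) : k.-tuple R :=
  [tuple tnth x (s j) | j < k].

Lemma measurable_flip_coord k (i : 'I_k) :
  measurable_fun [set: k.-tuple R] (flip_coord i).
Proof.
apply/measurable_fun_tnthP => j; rewrite /comp /flip_coord /=.
under eq_fun do rewrite tnth_mktuple.
case: eqP => _; last exact: measurable_tnth.
exact: measurable_funN (measurable_tnth j).
Qed.

Lemma measurable_perm_coord k (s : 'S_k) :
  measurable_fun [set: k.-tuple R] (perm_coord s).
Proof.
apply/measurable_fun_tnthP => j; rewrite /comp /perm_coord /=.
by under eq_fun do rewrite tnth_mktuple; exact: measurable_tnth.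
Qed.

Lemma lebesgue_integral_opp (f : R -> \bar R) :
  measurable_fun [set: measurableTypeR R] f -> (forall t, 0 <= f t)%E ->
  (\int[@lebesgue_measure R]_t f (- (t : R))%R = \int[@lebesgue_measure R]_t f t)%E.
Proof.
move=> mf f0.
have mopp : measurable_fun [set: measurableTypeR R] (-%R : R -> measurableTypeR R).
  exact: oppr_measurable.
transitivity (\int[pushforward (@lebesgue_measure R)
                  (-%R : _ -> measurableTypeR R)]_t f t)%E.
  by rewrite ge0_integral_pushforward// preimage_setT.
by apply: eq_measure_integral => //= A mA AS; exact: lebesgue_measureN.
Qed.

(** Either the flipped coordinate is the outermost one, and Lebesgue measure on the line is even, or
    the flip acts inside the inner integral and induction applies. *)
Lemma lebint_flip_coord k (i : 'I_k) (f : k.-tuple R -> \bar R) :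
  measurable_fun [set: k.-tuple R] f -> (forall x, 0 <= f x)%E ->
  lebint (fun x => f (flip_coord i x)) = lebint f.
Proof.
elim: k i f => [[]//|k IH] i f mf f0 /=.
case: (unliftP ord0 i) => [j|] ->.
- apply: eq_integral => t _.
  rewrite -[RHS](IH j)//; last exact: measurable_cons_fun.
  congr lebint; apply/funext => v; congr f; apply: eq_from_tnth => l.
  rewrite tnth_mktuple; case: (unliftP ord0 l) => [l'|] ->.
    by rewrite !tnthS tnth_mktuple (inj_eq lift_inj).
  by rewrite !tnth0.
- rewrite -[RHS]lebesgue_integral_opp//; last 2 first.
    exact: measurable_lebint_cons.
    by move=> t; exact: lebint_ge0.
  apply: eq_integral => t _.
  congr lebint; apply/funext => v; congr f; apply: eq_from_tnth => l.
  rewrite tnth_mktuple; case: (unliftP ord0 l) => [l'|] ->.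
    by rewrite !tnthS.
  by rewrite eqxx !tnth0.
Qed.

(** This is Tonelli for the two outermost integrals. *)
Lemma lebint_swap01 k (f : k.+2.-tuple R -> \bar R) :
  measurable_fun [set: k.+2.-tuple R] f -> (forall x, 0 <= f x)%E ->
  lebint (fun x => f (perm_coord (tperm ord0 (lift ord0 ord0)) x)) = lebint f.
Proof.
move=> mf f0 /=.
have swapE (t s : R) (v : k.-tuple R) :
    perm_coord (tperm ord0 (lift ord0 ord0)) (cons_tuple t (cons_tuple s v))
    = cons_tuple s (cons_tuple t v) :> k.+2.-tuple R.
  apply: eq_from_tnth => l; rewrite tnth_mktuple.
  case: (unliftP ord0 l) => [l'|] ->; last by rewrite tpermL tnth0 tnthS tnth0.
  case: (unliftP ord0 l') => [l''|] ->; last by rewrite tpermR !tnthS !tnth0.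
  by rewrite tpermD ?tnthS// -?(inj_eq lift_inj) (inj_eq lift_inj).
under eq_integral do under eq_integral do under eq_fun do rewrite swapE.
rewrite (fubini_tonelli (m1 := @lebesgue_measure R) (m2 := @lebesgue_measure R)
   (fun p => lebint (fun v : k.-tuple R => f (cons_tuple p.2 (cons_tuple p.1 v)))))//.
- apply: (@measurable_lebint k _ (measurableTypeR R * measurableTypeR R)%type
    (fun p => f (cons_tuple p.1.2 (cons_tuple p.1.1 p.2)))) => //.
  apply: measurableT_comp mf _.
  apply: measurable_cons_tuple; first exact: measurableT_comp.
  by apply: measurable_cons_tuple; first exact: measurableT_comp.
- by move=> p; exact: lebint_ge0.
Qed.

Lemma perm_coordM k (s t : 'S_k) (x : k.-tuple R) :
  perm_coord (s * t)%g x = perm_coord s (perm_coord t x).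
Proof. by apply: eq_from_tnth => j; rewrite !tnth_mktuple permM. Qed.

Lemma measurable_comp_perm_coord k (s : 'S_k) (f : k.-tuple R -> \bar R) :
  measurable_fun [set: k.-tuple R] f ->
  measurable_fun [set: k.-tuple R] (fun x => f (perm_coord s x)).
Proof. by move=> mf; exact: measurableT_comp mf (@measurable_perm_coord k s). Qed.

(** Transpositions fixing index 0 act inside the inner integral ([lifted]); those moving it reduce
    to the exchange of 0 and 1 ([zero]). *)
Lemma lebint_tperm k (i j : 'I_k) (f : k.-tuple R -> \bar R) :
  measurable_fun [set: k.-tuple R] f -> (forall x, 0 <= f x)%E ->
  lebint (fun x => f (perm_coord (tperm i j) x)) = lebint f.
Proof.
elim: k i j f => [[]//|k IH] i j f mf f0.
have lifted (i' j' : 'I_k) (g : k.+1.-tuple R -> \bar R) :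
    measurable_fun [set: k.+1.-tuple R] g -> (forall x, 0 <= g x)%E ->
    lebint (fun x => g (perm_coord (tperm (lift ord0 i') (lift ord0 j')) x))
    = lebint g.
  move=> mg g0 /=; apply: eq_integral => t _.
  rewrite -[RHS](IH i' j')//; last exact: measurable_cons_fun.
  congr lebint; apply/funext => v; congr g; apply: eq_from_tnth => l.
  rewrite tnth_mktuple; case: (unliftP ord0 l) => [l'|] ->.
    by rewrite !tnthS tnth_mktuple -(inj_tperm _ _ _ lift_inj) tnthS.
  by rewrite tpermD ?tnth0.
have zero (j' : 'I_k) (g : k.+1.-tuple R -> \bar R) :
    measurable_fun [set: k.+1.-tuple R] g -> (forall x, 0 <= g x)%E ->
    lebint (fun x => g (perm_coord (tperm ord0 (lift ord0 j')) x)) = lebint g.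
  case: k j' {IH i j f mf f0} lifted g => [[]//|k] j' lifted g mg g0.
  have [->|j'0] := eqVneq j' ord0; first exact: lebint_swap01.
  pose s := tperm (lift ord0 ord0) (lift ord0 j').
  (* The transposition (0 j) is (0 1) conjugated by [s], which exchanges 1 and j. The three factors
     are then removed one at a time through [h'] and [h]. *)
  have -> : tperm ord0 (lift ord0 j') =
      (s * tperm ord0 (lift ord0 ord0) * s)%g.
    rewrite -[X in (X * _ * _)%g]tpermV -mulgA -/(conjg _ _) tpermJ.
    by rewrite /s tpermL tpermD.
  under eq_fun do rewrite !perm_coordM.
  have ms := @measurable_comp_perm_coord _ s _ mg.
  pose h x := g (perm_coord s x).
  have mh : measurable_fun [set: k.+2.-tuple R] h := ms.
  have h0 x : (0 <= h x)%E by exact: g0.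
  pose h' x := h (perm_coord (tperm ord0 (lift ord0 ord0)) x).
  have mh' : measurable_fun [set: k.+2.-tuple R] h'.
    exact: measurable_comp_perm_coord mh.
  have h'0 x : (0 <= h' x)%E by exact: h0.
  transitivity (lebint h'); first exact: (lifted _ _ h' mh' h'0).
  transitivity (lebint h); first exact: lebint_swap01 mh h0.
  exact: (lifted _ _ g mg g0).
case: (unliftP ord0 i) => [i'|] ->; case: (unliftP ord0 j) => [j'|] ->.
- exact: lifted.
- by rewrite tpermC; exact: zero.
- exact: zero.
- congr lebint; apply/funext => x; congr f; apply: eq_from_tnth => l.
  by rewrite tnth_mktuple tperm1 perm1.
Qed.

End iterated_integral.

(** * The normalized surface measure *)

Section sphere_measure.
Context {R : realType}.

Lemma integral_mrestr d (T : measurableType d) (m : {measure set T -> \bar R})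
    (D : set T) (mD : measurable D) (f : T -> \bar R) :
  measurable_fun [set: T] f -> (forall x, 0 <= f x)%E ->
  (\int[mrestr m mD]_x f x = \int[m]_(x in D) f x)%E.
Proof.
move=> mf f0; have mDC := measurableC mD.
rewrite -(setUv D) ge0_integral_setU//; last 2 first.
- by rewrite setUv.
- by apply/eqP; exact: setICr.
rewrite [X in (_ + X)%E]null_set_integral//; last 2 first.
- exact: measurable_funTS.
- by rewrite /= /mrestr setICl measure0.
rewrite adde0; apply: eq_measure_integral => A mA AD.
by rewrite /= /mrestr setIidl.
Qed.

Lemma measurable_enorm k : measurable_fun [set: k.-tuple R] (@enorm R k).
Proof.
apply: measurableT_comp.
  by apply: continuous_measurable_fun; exact: sqrt_continuous.
apply: measurable_sum => j; apply: measurable_funX; exact: measurable_tnth.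
Qed.

Lemma measurable_punctured_ball k :
  measurable_fun [set: k.-tuple R] (fun x => (0 < enorm x) && (enorm x <= 1)).
Proof.
apply: measurable_and; [apply: measurable_fun_ltr|apply: measurable_fun_ler] => //;
  exact: measurable_enorm.
Qed.

Lemma measurable_normalize k : measurable_fun [set: k.-tuple R] (@normalize R k).
Proof.
apply/measurable_fun_tnthP => j.
(* The norm is nonnegative, so its inverse is its power with exponent -1, a measurable function. *)
rewrite (_ : _ \o _ = fun x : k.-tuple R => tnth x j * enorm x `^ (-1)).
  apply: measurable_funM; first exact: measurable_tnth.
  exact: measurableT_comp (@measurable_powR R (-1)) (@measurable_enorm k).
by apply/funext => x; rewrite /= tnth_map powR_inv1// sqrtr_ge0.
Qed.

(** The measure is Lebesgue measure restricted to the punctured unit ball, pushed forward by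
    [normalize] and divided by the ball volume. Later sections work with such an [s], characterized
    by [sE]. *)
Lemma sphere_intP d :
  exists s : {measure set (d.+1.-tuple R) -> \bar R},
  forall f : d.+1.-tuple R -> \bar R, measurable_fun [set: d.+1.-tuple R] f ->
    (forall x, 0 <= f x)%E -> sphere_int f = (\int[s]_x f x)%E.
Proof.
have [m Hm] := @lebint_measureP R d.+1.
have mB : measurable [set x : d.+1.-tuple R | (0 < enorm x) && (enorm x <= 1)].
  by rewrite -[X in measurable X]setTI; exact: measurable_punctured_ball.
have B0 : 0 <= (ball_vol R d.+1)^-1.
  rewrite invr_ge0 fine_ge0//; apply: lebint_ge0 => x.
  by rewrite lee_fin; case: ifP.
pose m1 := measure_function_pushforward__canonical__measure_function_Measure
  (mrestr m mB) (@measurable_normalize d.+1).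
exists (mscale (NngNum B0) m1) => f mf f0.
rewrite ge0_integral_mscale//= muleC; congr (_ * _)%E.
rewrite [RHS](@ge0_integral_pushforward _ _ _ _ _ _
  (@measurable_normalize d.+1) (mrestr m mB))//.
have mfn : measurable_fun [set: d.+1.-tuple R] (f \o @normalize R d.+1).
  exact: measurableT_comp mf (@measurable_normalize d.+1).
rewrite preimage_setT integral_mrestr//; last by move=> x; exact: f0.
rewrite integral_mkcond -Hm//; last 2 first.
- apply/(measurable_restrictT (f \o @normalize R d.+1) mB).
  exact: (measurable_funTS mfn).
- by move=> x; rewrite patchE; case: ifP => // _; exact: f0.
congr lebint; apply/funext => x; rewrite patchE /=.
by rewrite mem_setE.
Qed.

Section symmetry.
Context (d : nat) (T : d.+1.-tuple R -> d.+1.-tuple R).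
Hypothesis mT : measurable_fun [set: d.+1.-tuple R] T.
Hypothesis lebintT : forall f : d.+1.-tuple R -> \bar R,
  measurable_fun [set: d.+1.-tuple R] f -> (forall x, 0 <= f x)%E ->
  lebint (fun x => f (T x)) = lebint f.
Hypothesis enormT : forall x, enorm (T x) = enorm x.
Hypothesis normalizeT : forall x, normalize (T x) = T (normalize x).

(** The map preserves the punctured ball and commutes with radial projection, so invariance of
    [lebint] descends to the cone measure. *)
Lemma sphere_int_symmetry (f : d.+1.-tuple R -> \bar R) :
  measurable_fun [set: d.+1.-tuple R] f -> (forall x, 0 <= f x)%E ->
  sphere_int (fun x => f (T x)) = sphere_int f.
Proof.
move=> mf f0; rewrite /sphere_int; congr (_ * _)%E.
rewrite -[RHS]lebintT.
- congr lebint; apply/funext => x; rewrite enormT; case: ifP => // _.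
  by rewrite normalizeT.
- apply: measurable_fun_ifT => //; first exact: measurable_punctured_ball.
  exact: measurableT_comp mf (@measurable_normalize d.+1).
- by move=> x; case: ifP.
Qed.

End symmetry.

Lemma enorm_flip_coord k (i : 'I_k) (x : k.-tuple R) :
  enorm (flip_coord i x) = enorm x.
Proof.
congr Num.sqrt; apply: eq_bigr => j _; rewrite tnth_mktuple.
by case: ifP; rewrite ?sqrrN.
Qed.

Lemma normalize_flip_coord k (i : 'I_k) (x : k.-tuple R) :
  normalize (flip_coord i x) = flip_coord i (normalize x).
Proof.
apply: eq_from_tnth => j; rewrite tnth_map !tnth_mktuple enorm_flip_coord.
by rewrite tnth_map; case: ifP; rewrite ?mulNr.
Qed.

Lemma enorm_perm_coord k (s : 'S_k) (x : k.-tuple R) :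
  enorm (perm_coord s x) = enorm x.
Proof.
congr Num.sqrt; rewrite [RHS](reindex_inj (@perm_inj _ s)).
by apply: eq_bigr => j _; rewrite tnth_mktuple.
Qed.

Lemma normalize_perm_coord k (s : 'S_k) (x : k.-tuple R) :
  normalize (perm_coord s x) = perm_coord s (normalize x).
Proof.
apply: eq_from_tnth => j.
by rewrite tnth_map !tnth_mktuple tnth_map enorm_perm_coord.
Qed.

Lemma sphere_int_flip_coord d (i : 'I_d.+1) (f : d.+1.-tuple R -> \bar R) :
  measurable_fun [set: d.+1.-tuple R] f -> (forall x, 0 <= f x)%E ->
  sphere_int (fun x => f (flip_coord i x)) = sphere_int f.
Proof.
apply: sphere_int_symmetry => //.
- exact: lebint_flip_coord.
- exact: enorm_flip_coord.
- exact: normalize_flip_coord.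
Qed.

Lemma sphere_int_tperm d (i j : 'I_d.+1) (f : d.+1.-tuple R -> \bar R) :
  measurable_fun [set: d.+1.-tuple R] f -> (forall x, 0 <= f x)%E ->
  sphere_int (fun x => f (perm_coord (tperm i j) x)) = sphere_int f.
Proof.
apply: sphere_int_symmetry => //.
- exact: lebint_tperm.
- exact: enorm_perm_coord.
- exact: normalize_perm_coord.
Qed.

Lemma sphere_int_ge0 d (f : d.+1.-tuple R -> \bar R) :
  (forall x, 0 <= f x)%E -> (0 <= sphere_int f)%E.
Proof.
move=> f0; apply: mule_ge0.
  by apply: lebint_ge0 => x; case: ifP.
rewrite lee_fin invr_ge0 fine_ge0//; apply: lebint_ge0 => x.
by rewrite lee_fin; case: ifP.
Qed.

End sphere_measure.

(** * Frobenius inner product and second moments *)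

Section frobenius.
Context {R : realType}.

Definition frob_dot m p (A B : 'M[R]_(m, p)) : R :=
  \sum_i \sum_j A i j * B i j.

Lemma frob_dotC m p (A B : 'M[R]_(m, p)) : frob_dot A B = frob_dot B A.
Proof. by apply: eq_bigr => i _; apply: eq_bigr => j _; rewrite mulrC. Qed.

Lemma frob_dotZr m p (a : R) (A B : 'M[R]_(m, p)) :
  frob_dot A (a *: B) = a * frob_dot A B.
Proof.
rewrite /frob_dot mulr_sumr; apply: eq_bigr => i _.
by rewrite mulr_sumr; apply: eq_bigr => j _; rewrite mxE mulrCA.
Qed.

Lemma frob2_dot m p (A : 'M[R]_(m, p)) : frob2 A = frob_dot A A.
Proof. by apply: eq_bigr => i _; apply: eq_bigr => j _; rewrite expr2. Qed.

Lemma frob2_ge0 m p (A : 'M[R]_(m, p)) : 0 <= frob2 A.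
Proof. by apply: sumr_ge0 => i _; apply: sumr_ge0 => j _; exact: sqr_ge0. Qed.

Lemma frob20 m p : frob2 (0 : 'M[R]_(m, p)) = 0.
Proof.
by rewrite /frob2 big1// => i _; rewrite big1// => j _; rewrite mxE expr0n.
Qed.

Lemma frob2DZ m p (A B : 'M[R]_(m, p)) (e : R) :
  frob2 (A + e *: B) = frob2 A + 2 * e * frob_dot A B + e ^+ 2 * frob2 B.
Proof.
rewrite /frob2 /frob_dot !mulr_sumr -!big_split/=; apply: eq_bigr => i _.
rewrite !mulr_sumr -!big_split/=; apply: eq_bigr => j _.
by rewrite !mxE; ring.
Qed.

Definition outer k (x : k.-tuple R) : 'M[R]_k :=
  \matrix_(i, j) (tnth x i * tnth x j).

(** The product of the transposed analysis matrix with itself, written as a sum over points so that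
    they can be integrated out one by one. *)
Definition gram k (xs : seq (k.-tuple R)) : 'M[R]_k := \sum_(x <- xs) outer x.

Lemma frob_dot_outer k (x y : k.-tuple R) :
  frob_dot (outer x) (outer y) = (\sum_i tnth x i * tnth y i) ^+ 2.
Proof.
rewrite expr2 big_distrlr /=; apply: eq_bigr => i _; apply: eq_bigr => j _.
by rewrite !mxE mulrACA.
Qed.

Lemma gramE d (xs : seq (d.+1.-tuple R)) :
  (analysis_matrix d (size xs) xs)^T *m analysis_matrix d (size xs) xs = gram xs.
Proof.
(* The matrix has exactly [size xs] rows, so the default zero row is never read. *)
apply/matrixP => i j; rewrite !mxE /gram summxE (big_nth [tuple of nseq d.+1 0]).
by rewrite big_mkord; apply: eq_bigr => l _; rewrite !mxE.
Qed.

Lemma sphere_sqr d (x : d.+1.-tuple R) :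
  sphere d x -> \sum_i tnth x i ^+ 2 = 1.
Proof.
rewrite /sphere /= /enorm => x1.
have : 0 <= \sum_i tnth x i ^+ 2 by apply: sumr_ge0 => i _; exact: sqr_ge0.
by move=> /sqr_sqrtr <-; rewrite x1 expr1n.
Qed.

Lemma sphere_frob2_outer d (x : d.+1.-tuple R) :
  sphere d x -> frob2 (outer x) = 1.
Proof.
move=> /sphere_sqr x1; rewrite frob2_dot frob_dot_outer.
by under eq_bigr do rewrite -expr2; rewrite x1 expr1n.
Qed.

Lemma sphere_coord_le1 d (x : d.+1.-tuple R) i : sphere d x -> `|tnth x i| <= 1.
Proof.
move=> /sphere_sqr x1.
rewrite -(@expr_le1 _ 2%N)// real_normK ?num_real// -x1 (bigD1 i)//= lerDl.
by apply: sumr_ge0 => j _; exact: sqr_ge0.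
Qed.

(** Polarization for unit vectors; it converts the diameter bound into a lower bound on inner
    products. *)
Lemma sphere_dot d (x y : d.+1.-tuple R) : sphere d x -> sphere d y ->
  \sum_i tnth x i * tnth y i = 1 - eucl_dist x y ^+ 2 / 2.
Proof.
move=> /sphere_sqr x1 /sphere_sqr y1.
rewrite /eucl_dist sqr_sqrtr; last by apply: sumr_ge0 => i _; exact: sqr_ge0.
have -> : \sum_i (tnth x i - tnth y i) ^+ 2 =
    \sum_i tnth x i ^+ 2 + \sum_i tnth y i ^+ 2 - 2 * \sum_i tnth x i * tnth y i.
  rewrite mulr_sumr -big_split -sumrB; apply: eq_bigr => i _ /=; ring.
by rewrite x1 y1; lra.
Qed.

End frobenius.

(** * Second-moment matrices of subsets of the sphere *)

Section moments.
Context {R : realType}.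

Lemma integrable_sumr d (T : measurableType d) (m : {measure set T -> \bar R})
    (D : set T) (I : Type) (r : seq I) (f : I -> T -> R) : measurable D ->
  (forall i, m.-integrable D (EFin \o f i)) ->
  m.-integrable D (EFin \o (fun x => \sum_(i <- r) f i x)).
Proof.
move=> mD intf.
rewrite (_ : EFin \o _ = fun x => (\sum_(i <- r) (f i x)%:E)%E).
  by apply: (integrable_sum mD) => i _; exact: intf.
by apply/funext => x; rewrite /= sumEFin.
Qed.

Lemma Rintegral_sum d (T : measurableType d) (m : {measure set T -> \bar R})
    (D : set T) (I : Type) (r : seq I) (f : I -> T -> R) : measurable D ->
  (forall i, m.-integrable D (EFin \o f i)) ->
  \int[m]_(x in D) (\sum_(i <- r) f i x) = \sum_(i <- r) \int[m]_(x in D) f i x.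
Proof.
move=> mD intf; elim: r => [|i r IH].
  under eq_Rintegral do rewrite big_nil.
  by rewrite Rintegral_cst// mul0r big_nil.
under eq_Rintegral do rewrite big_cons.
by rewrite big_cons RintegralD// ?IH//; exact: integrable_sumr.
Qed.

Context (d : nat) (s : {measure set (d.+1.-tuple R) -> \bar R}).

(** Left unnormalized so that contributions of the cells simply add up. *)
Definition moment_mx (D : set (d.+1.-tuple R)) : 'M[R]_d.+1 :=
  \matrix_(a, b) \int[s]_(x in D) (tnth x a * tnth x b).

Section one_cell.
Context (D : set (d.+1.-tuple R)) (mD : measurable D) (DS : D `<=` sphere d).
Hypothesis Dfin : (s D < +oo)%E.

Lemma measurable_coordM a b :
  measurable_fun [set: d.+1.-tuple R] (fun x => tnth x a * tnth x b).
Proof. apply: measurable_funM; exact: measurable_tnth. Qed.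

Lemma integrable_coordM a b :
  s.-integrable D (EFin \o (fun x => tnth x a * tnth x b)).
Proof.
apply: measurable_bounded_integrable => //.
  exact: (measurable_funTS (measurable_coordM a b)).
exists 1; split => // M M1 x /= Dx; rewrite normrM (le_trans _ (ltW M1))//.
by rewrite mulr_ile1 ?sphere_coord_le1//; exact: DS.
Qed.

Lemma integrable_frob_dot_outer (B : 'M[R]_d.+1) :
  s.-integrable D (EFin \o (fun x => frob_dot B (outer x))).
Proof.
apply: integrable_sumr => // i; apply: integrable_sumr => // j.
rewrite (_ : EFin \o _ = fun x => ((B i j)%:E * (tnth x i * tnth x j)%:E)%E).
  by apply: integrableZl => //; exact: integrable_coordM.
by apply/funext => x; rewrite /= mxE.
Qed.

Lemma Rintegral_frob_dot_outer (B : 'M[R]_d.+1) :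
  \int[s]_(x in D) frob_dot B (outer x) = frob_dot B (moment_mx D).
Proof.
have int1 i j : s.-integrable D (EFin \o (fun x => B i j * outer x i j)).
  rewrite (_ : EFin \o _ = fun x => ((B i j)%:E * (tnth x i * tnth x j)%:E)%E).
    by apply: integrableZl => //; exact: integrable_coordM.
  by apply/funext => x; rewrite /= mxE.
rewrite Rintegral_sum//; last by move=> i; exact: integrable_sumr.
apply: eq_bigr => i _; rewrite Rintegral_sum//; apply: eq_bigr => j _.
under eq_Rintegral do rewrite mxE.
by rewrite RintegralZl ?mxE//; exact: integrable_coordM.
Qed.

End one_cell.

End moments.

(** * The bias-variance identity for jittered sampling *)

Section jittered_sampling.
Context {R : realType} (d : nat) (s : {measure set (d.+1.-tuple R) -> \bar R}).
Hypothesis sE : forall f : d.+1.-tuple R -> \bar R,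
  measurable_fun [set: d.+1.-tuple R] f -> (forall x, 0 <= f x)%E ->
  sphere_int f = (\int[s]_x f x)%E.

Lemma sphere_int_indic (D : set (d.+1.-tuple R)) (f : d.+1.-tuple R -> R) :
  measurable D -> measurable_fun [set: d.+1.-tuple R] f -> (forall x, 0 <= f x) ->
  sphere_int (fun x => (\1_D x)%:E * (f x)%:E)%E = (\int[s]_(x in D) (f x)%:E)%E.
Proof.
move=> mD mf f0; rewrite sE.
- rewrite [RHS]integral_mkcond; apply: eq_integral => x _; rewrite patchE indicE.
  by case: ifP => _; rewrite ?mul1e ?mul0e.
- apply: emeasurable_funM; apply/measurable_EFinP => //.
- by move=> x; rewrite mule_ge0// lee_fin.
Qed.

Lemma sphere_measE (D : set (d.+1.-tuple R)) : measurable D -> sphere_meas D = s D.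
Proof.
move=> mD; rewrite /sphere_meas sE; first by rewrite integral_indic// setIT.
- by apply/measurable_EFinP; exact: measurable_indic.
- by move=> x; rewrite lee_fin.
Qed.

Lemma jitter_exp_ge0 (Ds : seq (set (d.+1.-tuple R))) F :
  (forall xs, 0 <= F xs)%E -> (0 <= jitter_exp Ds F)%E.
Proof.
elim: Ds F => [|D Ds IH] F F0 /=; first exact: F0.
rewrite mule_ge0//.
  apply: sphere_int_ge0 => x; rewrite mule_ge0 ?lee_fin//; exact: IH.
rewrite lee_fin invr_ge0 fine_ge0//; apply: sphere_int_ge0 => x.
by rewrite lee_fin.
Qed.

(** The recursion evaluates its functional only on lists with one point per cell; the size condition
    is what lets [gramE] be applied under the expectation. *)
Lemma eq_jitter_exp (Ds : seq (set (d.+1.-tuple R))) F G :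
  (forall xs, size xs = size Ds -> F xs = G xs) -> jitter_exp Ds F = jitter_exp Ds G.
Proof.
elim: Ds F G => [|D Ds IH] F G FG /=; first exact: FG.
congr (sphere_int _ * _)%E; apply/funext => x; congr (_ * _)%E.
by apply: IH => xs xsDs; apply: FG; rewrite /= xsDs.
Qed.

Lemma measurable_outer_ij (i j : 'I_d.+1) :
  measurable_fun [set: d.+1.-tuple R] (fun x => outer x i j).
Proof.
rewrite (_ : (fun x => _) = fun x => tnth x i * tnth x j).
  exact: measurable_coordM.
by apply/funext => x; rewrite mxE.
Qed.

Lemma measurable_frob2_outer (A : 'M[R]_d.+1) (e : R) :
  measurable_fun [set: d.+1.-tuple R] (fun x => frob2 (A + e *: outer x)).
Proof.
apply: measurable_sum => i; apply: measurable_sum => j; apply: measurable_funX.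
rewrite (_ : (fun x => _) = fun x => A i j + e * outer x i j).
  apply: measurable_funD => //; apply: measurable_funM => //.
  exact: measurable_outer_ij.
by apply/funext => x; rewrite !mxE.
Qed.

Context (w : R) (w0 : 0 < w).

Definition cell (D : set (d.+1.-tuple R)) :=
  [/\ measurable D, D `<=` sphere d & sphere_meas D = w%:E].

(** On a cell, whose mass is [w], this is the mean of [outer x] for [x] uniform in the cell. *)
Definition second_moment (D : set (d.+1.-tuple R)) : 'M[R]_d.+1 :=
  w^-1 *: moment_mx s D.

Lemma cell_meas D : cell D -> s D = w%:E.
Proof. by case=> mD _; rewrite sphere_measE. Qed.

Lemma cell_finite D : cell D -> (s D < +oo)%E.
Proof. by move=> cD; rewrite cell_meas// ltry. Qed.

Lemma frob_dot_second_moment (B : 'M[R]_d.+1) D : cell D ->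
  frob_dot B (second_moment D) = w^-1 * \int[s]_(x in D) frob_dot B (outer x).
Proof.
move=> cD; have [mD DS _] := cD.
by rewrite frob_dotZr Rintegral_frob_dot_outer//; exact: cell_finite.
Qed.

Lemma frob_dot_second_moment_ge (B : 'M[R]_d.+1) D (a : R) : cell D ->
  (forall x, D x -> a <= frob_dot B (outer x)) ->
  a <= frob_dot B (second_moment D).
Proof.
move=> cD aB; have [mD DS _] := cD; have Dfin := cell_finite cD.
rewrite frob_dot_second_moment// -ler_pdivrMl ?invr_gt0// invrK mulrC.
have -> : a * w = \int[s]_(x in D) a by rewrite Rintegral_cst// cell_meas.
apply: le_Rintegral => //; last exact: integrable_frob_dot_outer.
by apply: measurable_bounded_integrable => //; exact: bounded_cst.
Qed.

(* The double average of <x, y>^2 over D is taken one variable at a time. *)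
Lemma frob2_second_moment_ge D (a : R) : cell D -> 0 <= a ->
  (forall x y, D x -> D y -> a <= \sum_i tnth x i * tnth y i) ->
  a ^+ 2 <= frob2 (second_moment D).
Proof.
move=> cD a0 aD; rewrite frob2_dot; apply: frob_dot_second_moment_ge => // y Dy.
rewrite frob_dotC; apply: frob_dot_second_moment_ge => // x Dx.
by rewrite frob_dot_outer ler_pXn2r ?nnegrE ?(le_trans a0) ?aD.
Qed.

(** Bias-variance for one point: expand the square, use that [outer x] has norm 1 on the sphere, and
    complete the square around the mean. [C] stands for the variance of the points already
    integrated out. *)
Lemma cell_average (A : 'M[R]_d.+1) (e C : R) D : cell D -> 0 <= C ->
  (sphere_int (fun x => (\1_D x)%:E * (frob2 (A + e *: outer x) + C)%:E)
    * ((fine (sphere_meas D))^-1)%:E)%E =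
  (frob2 (A + e *: second_moment D)
    + e ^+ 2 * (1 - frob2 (second_moment D)) + C)%:E.
Proof.
move=> cD C0; have [mD DS ->] := cD; have Dfin := cell_finite cD.
rewrite sphere_int_indic//; last 2 first.
- by apply: measurable_funD => //; exact: measurable_frob2_outer.
- by move=> x; rewrite addr_ge0 ?frob2_ge0.
have intc (r : R) : s.-integrable D (EFin \o (fun=> r)).
  by apply: measurable_bounded_integrable => //; exact: bounded_cst.
have intB (B : 'M[R]_d.+1) := integrable_frob_dot_outer mD DS Dfin B.
pose g x : R := frob_dot A (outer x).
have Eg : forall x, D x -> frob2 (A + e *: outer x) + C =
    (frob2 A + e ^+ 2 + C) + 2 * e * g x.
  by move=> x /DS Sx; rewrite frob2DZ sphere_frob2_outer// /g; ring.
have intg : s.-integrable D (EFin \o (fun x => 2 * e * g x)).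
  rewrite (_ : EFin \o _ = fun x => ((2 * e)%:E * (EFin \o g) x)%E)//.
  by apply: integrableZl => //; exact: intB.
rewrite (eq_integral (fun x =>
    ((frob2 A + e ^+ 2 + C) + 2 * e * g x)%:E)); last first.
  by move=> x /[!inE] Dx; rewrite Eg.
(* The integral is finite, so the computation moves to the reals, where the integral of the affine
   function of [g] splits. *)
rewrite -[X in (X * _)%E]fineK; last first.
  apply: integrable_fin_num => //.
  rewrite (_ : (fun x => _) =
    fun x => ((frob2 A + e ^+ 2 + C)%:E + (2 * e * g x)%:E)%E)//.
  exact: (integrableD mD (intc _) intg).
rewrite -EFinM; congr EFin.
rewrite -/(Rintegral s D (fun x => (frob2 A + e ^+ 2 + C) + 2 * e * g x)).
rewrite RintegralD// Rintegral_cst// RintegralZl//; last exact: intB.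
rewrite cell_meas//= frob2DZ frob_dot_second_moment// -/g; field.
by rewrite gt_eqF.
Qed.

(** Induction on the cells for all [A] at once: with the first point fixed, its term is absorbed
    into [A] and the remaining points are averaged by induction; [cell_average] then treats the
    first point. *)
Lemma jitter_exp_frob2 (A : 'M[R]_d.+1) (e : R) (Ds : seq (set (d.+1.-tuple R))) :
  (forall D, List.In D Ds -> cell D) ->
  jitter_exp Ds (fun xs => (frob2 (A + e *: gram xs))%:E) =
  (frob2 (A + e *: \sum_(D <- Ds) second_moment D)
    + e ^+ 2 * \sum_(D <- Ds) (1 - frob2 (second_moment D)))%:E.
Proof.
elim: Ds A => [|D Ds IH] A cDs /=.
  by rewrite /gram !big_nil mulr0 addr0.
have {}IH B := IH B (fun D DDs => cDs D (or_intror DDs)).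
have cD := cDs D (or_introl erefl).
set N := \sum_(D <- Ds) second_moment D in IH *.
set C := e ^+ 2 * _ in IH *.
(* Taking [- (e *: N)] as the matrix cancels the bias, so [C] itself is the expectation of a squared
   norm. *)
have C0 : 0 <= C.
  have := jitter_exp_ge0 Ds (F := fun xs => (frob2 (- (e *: N) + e *: gram xs))%:E).
  rewrite IH addNr frob20 add0r lee_fin; apply => xs; rewrite lee_fin.
  exact: frob2_ge0.
transitivity (sphere_int (fun x => (\1_D x)%:E *
    (frob2 ((A + e *: N) + e *: outer x) + C)%:E)
    * ((fine (sphere_meas D))^-1)%:E)%E.
  congr (sphere_int _ * _)%E; apply/funext => x; congr (_ * _)%E.
  rewrite [A + _ + _]addrAC -IH; apply: eq_jitter_exp => xs _.
  by rewrite /gram big_cons scalerDr addrA.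
rewrite cell_average// !big_cons -/N; congr EFin.
by rewrite scalerDr (addrC (e *: second_moment D)) [X in _ = _ + X]mulrDr -/C !addrA.
Qed.

End jittered_sampling.

(** * The second moment of the whole sphere *)

Section partition.
Context {R : realType} (d n : nat) (s : {measure set (d.+1.-tuple R) -> \bar R}).
Hypothesis sE : forall f : d.+1.-tuple R -> \bar R,
  measurable_fun [set: d.+1.-tuple R] f -> (forall x, 0 <= f x)%E ->
  sphere_int f = (\int[s]_x f x)%E.
Context (D : 'I_n -> set (d.+1.-tuple R)).
Hypothesis mD : forall i, measurable (D i).
Hypothesis coverD : \bigcup_(i in [set: 'I_n]) D i = sphere d.
Hypothesis disjD : forall j k, j != k -> s (D j `&` D k) = 0%E.
Hypothesis finD : forall i, (s (D i) < +oo)%E.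

Lemma partition_subset i : D i `<=` sphere d.
Proof. by rewrite -coverD; exact: bigcup_sup. Qed.

Lemma measurable_sphere : measurable (sphere d : set (d.+1.-tuple R)).
Proof. by rewrite -coverD; exact: fin_bigcup_measurable. Qed.

(** Almost everywhere the indicators of the cells add up to the indicator of the sphere. *)
Lemma sum_integral_partition (f : d.+1.-tuple R -> R) :
  measurable_fun [set: d.+1.-tuple R] f -> (forall x, 0 <= f x) ->
  (\sum_(i < n) \int[s]_(x in D i) (f x)%:E =
   sphere_int (fun x => (\1_(sphere d) x)%:E * (f x)%:E))%E.
Proof.
move=> mf f0.
have mS := measurable_sphere.
have mindic (A : set (d.+1.-tuple R)) : measurable A ->
    measurable_fun [set: d.+1.-tuple R] (fun x => (\1_A x)%:E * (f x)%:E)%E.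
  move=> mA; apply: emeasurable_funM; apply/measurable_EFinP => //.
have indic0 (A : set (d.+1.-tuple R)) x : (0 <= (\1_A x)%:E * (f x)%:E)%E.
  by rewrite mule_ge0// lee_fin.
rewrite sE//; last exact: mindic.
transitivity (\int[s]_x \sum_(i < n) ((\1_(D i) x)%:E * (f x)%:E))%E.
  rewrite ge0_integral_sum//; last by move=> i; exact: mindic.
  by apply: eq_bigr => i _; rewrite -(sphere_int_indic sE)// sE//; exact: mindic.
apply: ge0_ae_eq_integral => //.
- by apply: emeasurable_sum => i; exact: mindic.
- exact: mindic.
- by move=> x _; apply: sume_ge0.
(* The exceptional set is the union of the pairwise overlaps, indexed by natural codes of pairs to
   make it a countable union of null sets; all other codes give the empty set. *)
pose F m := if unpickle m is Some p then
    (if p.1 != p.2 :> 'I_n then D p.1 `&` D p.2 else set0) else set0.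
have negl : s.-negligible (\bigcup_m F m).
  apply: negligible_bigcup => m; rewrite /F.
  case: unpickle => [[j k]|]; last exact: negligible_set0.
  case: ifP => [jk|_]; last exact: negligible_set0.
  by apply/negligibleP; [exact: measurableI|exact: disjD].
apply: negligibleS negl => x /= /not_implyP[_ neq].
apply: contrapT => xN; apply: neq.
rewrite -ge0_sume_distrl; last by move=> i _; rewrite lee_fin.
congr (_ * _)%E.
have uniqD j k : D j x -> D k x -> j = k.
  move=> Dj Dk; apply/eqP/negPn/negP => jk; apply: xN.
  by exists (pickle (j, k)) => //; rewrite /F pickleK /= jk.
have [[i Di]|noD] := pselect (exists i, D i x).
  rewrite (bigD1 i)//= big1 ?adde0.
    by rewrite !indicE !mem_set//; exact: partition_subset Di.
  move=> j ji; rewrite indicE memNset//= => Dj.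
  by rewrite (uniqD j i)// eqxx in ji.
rewrite big1; last first.
  by move=> i _; rewrite indicE memNset// => Di; apply: noD; exists i.
by rewrite indicE memNset// -coverD => -[i _ Di]; apply: noD; exists i.
Qed.

Section symmetry.
Context (T : d.+1.-tuple R -> d.+1.-tuple R).
Hypothesis mT : measurable_fun [set: d.+1.-tuple R] T.
Hypothesis enormT : forall x, enorm (T x) = enorm x.
Hypothesis sphere_intT : forall f : d.+1.-tuple R -> \bar R,
  measurable_fun [set: d.+1.-tuple R] f -> (forall x, 0 <= f x)%E ->
  sphere_int (fun x => f (T x)) = sphere_int f.

(** A symmetry need not respect single cells, but the sum over all cells is an integral over the
    sphere, which it preserves. *)
Lemma sum_Rintegral_symmetry (f : d.+1.-tuple R -> R) :
  measurable_fun [set: d.+1.-tuple R] f -> (forall x, 0 <= f x) ->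
  (forall i, s.-integrable (D i) (EFin \o f)) ->
  (forall i, s.-integrable (D i) (EFin \o (f \o T))) ->
  \sum_(i < n) \int[s]_(x in D i) f (T x) = \sum_(i < n) \int[s]_(x in D i) f x.
Proof.
move=> mf f0 intf intfT.
have RE (g : d.+1.-tuple R -> R) : (forall i, s.-integrable (D i) (EFin \o g)) ->
    (\sum_(i < n) \int[s]_(x in D i) g x)%:E =
    (\sum_(i < n) \int[s]_(x in D i) (g x)%:E)%E.
  move=> intg; rewrite -sumEFin; apply: eq_bigr => i _.
  by rewrite fineK//; exact: (integrable_fin_num (mD i) (intg i)).
apply: EFin_inj; rewrite (RE (f \o T))// RE//.
rewrite !sum_integral_partition//; last 2 first.
- exact: measurableT_comp mf mT.
- by move=> x; exact: f0.
rewrite -[RHS]sphere_intT.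
- congr sphere_int; apply/funext => x; congr (_%:E * _)%E.
  rewrite !indicE; congr (nat_of_bool _)%:R.
  by apply/idP/idP; rewrite !inE /sphere/= enormT.
- apply: emeasurable_funM; apply/measurable_EFinP => //.
  by apply: measurable_indic; exact: measurable_sphere.
- by move=> x; rewrite mule_ge0// lee_fin.
Qed.

End symmetry.

Let N : 'M[R]_d.+1 := \sum_(i < n) moment_mx s (D i).

(** Invariance is available for nonnegative functions only, so products of coordinates are reached
    through these squares: [e] equal to 1 and -1 serves off the diagonal, 0 on it. *)
Lemma Rintegral_sqr_coordD (a b : 'I_d.+1) (e : R) i :
  s.-integrable (D i) (EFin \o (fun x => (tnth x a + e * tnth x b) ^+ 2)) /\
  \int[s]_(x in D i) ((tnth x a + e * tnth x b) ^+ 2) =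
  moment_mx s (D i) a a + 2 * e * moment_mx s (D i) a b
    + e ^+ 2 * moment_mx s (D i) b b.
Proof.
(* Coefficient matrix of the quadratic form: pairing it with [outer x] gives the square. *)
pose B : 'M[R]_d.+1 :=
  delta_mx a a + (2 * e) *: delta_mx a b + e ^+ 2 *: delta_mx b b.
have dotB (C : 'M[R]_d.+1) : frob_dot B C = C a a + 2 * e * C a b + e ^+ 2 * C b b.
  have delta u v : frob_dot (delta_mx u v) C = C u v.
    rewrite /frob_dot (bigD1 u)//= [X in _ + X]big1 ?addr0; last first.
      by move=> j ju; rewrite big1// => k _; rewrite mxE (negbTE ju) mul0r.
    rewrite (bigD1 v)//= mxE !eqxx mul1r big1 ?addr0// => k kv.
    by rewrite mxE (negbTE kv) andbF mul0r.
  rewrite -!delta /frob_dot !mulr_sumr -!big_split/=; apply: eq_bigr => j _.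
  rewrite !mulr_sumr -!big_split/=; apply: eq_bigr => k _.
  by rewrite !mxE; ring.
have -> : (fun x : d.+1.-tuple R => (tnth x a + e * tnth x b) ^+ 2) =
    (fun x => frob_dot B (outer x)).
  by apply/funext => x; rewrite dotB !mxE; ring.
have Si := @partition_subset i.
split; first exact: integrable_frob_dot_outer (mD i) Si (finD i) B.
by rewrite -dotB; exact: Rintegral_frob_dot_outer (mD i) Si (finD i) B.
Qed.

Lemma sum_Rintegral_sqr_coordD (a b : 'I_d.+1) (e : R) :
  \sum_(i < n) \int[s]_(x in D i) ((tnth x a + e * tnth x b) ^+ 2) =
  N a a + 2 * e * N a b + e ^+ 2 * N b b.
Proof.
rewrite /N !summxE !mulr_sumr -!big_split/=; apply: eq_bigr => i _.
exact: (Rintegral_sqr_coordD a b e i).2.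
Qed.

Lemma measurable_sqr_coordD (a b : 'I_d.+1) (e : R) :
  measurable_fun [set: d.+1.-tuple R] (fun x => (tnth x a + e * tnth x b) ^+ 2).
Proof.
apply: measurable_funX; apply: measurable_funD; first exact: measurable_tnth.
by apply: measurable_funM => //; exact: measurable_tnth.
Qed.

(** Reflecting coordinate [b] exchanges the squares for [e] equal to 1 and -1, whose integrals
    differ by four times this entry. *)
Lemma sum_moment_offdiag a b : a != b -> N a b = 0.
Proof.
move=> ab.
have := sum_Rintegral_sqr_coordD a b 1.
rewrite -(sum_Rintegral_symmetry (T := flip_coord b)).
- under eq_bigr do under eq_Rintegral do
    rewrite !tnth_mktuple eqxx (negbTE ab) mul1r -mulN1r.
  by rewrite (sum_Rintegral_sqr_coordD a b (-1)); lra.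
- exact: measurable_flip_coord.
- exact: enorm_flip_coord.
- exact: sphere_int_flip_coord.
- exact: measurable_sqr_coordD.
- by move=> x; exact: sqr_ge0.
- by move=> i; exact: (Rintegral_sqr_coordD a b 1 i).1.
- move=> i; have := (Rintegral_sqr_coordD a b (-1) i).1; congr (_.-integrable _ _).
  by apply/funext => x /=; rewrite !tnth_mktuple eqxx (negbTE ab) mul1r mulN1r.
Qed.

Lemma sum_moment_diag a b : N a a = N b b.
Proof.
have := sum_Rintegral_sqr_coordD a b 0.
rewrite !mulr0 !mul0r expr0n/= mul0r !addr0 => <-.
have := sum_Rintegral_sqr_coordD b a 0.
rewrite !mulr0 !mul0r expr0n/= mul0r !addr0 => <-.
rewrite -[LHS](sum_Rintegral_symmetry (T := perm_coord (tperm a b))).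
- apply: eq_bigr => i _; apply: eq_Rintegral => x _.
  by rewrite !tnth_mktuple tpermL !mul0r.
- exact: measurable_perm_coord.
- exact: enorm_perm_coord.
- exact: sphere_int_tperm.
- exact: measurable_sqr_coordD.
- by move=> x; exact: sqr_ge0.
- by move=> i; exact: (Rintegral_sqr_coordD a b 0 i).1.
- move=> i; have := (Rintegral_sqr_coordD b a 0 i).1; congr (_.-integrable _ _).
  by apply/funext => x /=; rewrite !tnth_mktuple tpermL !mul0r.
Qed.

(** On the sphere the squared coordinates sum to 1, so each cell contributes its mass. *)
Lemma trace_sum_moment : \tr N = \sum_(i < n) fine (s (D i)).
Proof.
rewrite /N raddf_sum /=; apply: eq_bigr => i _.
transitivity (\int[s]_(x in D i) 1 : R); last by rewrite Rintegral_cst// mul1r.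
transitivity (\int[s]_(x in D i) (\sum_(a < d.+1) tnth x a * tnth x a)).
  rewrite Rintegral_sum//; first by apply: eq_bigr => a _; rewrite mxE.
  by move=> a; exact: (integrable_coordM (mD i) (@partition_subset i) (finD i)).
apply: eq_Rintegral => x /[!inE] /partition_subset /sphere_sqr <-.
by apply: eq_bigr => a _; rewrite expr2.
Qed.

Lemma sum_moment : \sum_(i < n) fine (s (D i)) = 1 -> N = d.+1%:R^-1 *: 1%:M.
Proof.
rewrite -trace_sum_moment => trN; apply/matrixP => a b.
have [<-|ab] := eqVneq a b; last first.
  by rewrite sum_moment_offdiag// !mxE (negbTE ab) mulr0.
rewrite !mxE eqxx mulr1; have d0 : d.+1%:R != 0 :> R by rewrite pnatr_eq0.
apply: (mulfI d0); rewrite mulfV// -[RHS]trN /mxtrace.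
rewrite [RHS](eq_bigr (fun=> N a a)); last by move=> c _; exact: sum_moment_diag.
by rewrite sumr_const card_ord mulr_natl.
Qed.

End partition.

(** * The variance bound from the diameters of the cells *)

Theorem theorem2 (R : realType) (d n : nat) (hd : (0 < d)%N) (hn : (0 < n)%N)
  (D : 'I_n -> set (d.+1.-tuple R)) (c : R)
  (hmeas : forall i, measurable (D i))
  (hcover : \bigcup_(i in [set: 'I_n]) D i = sphere d)
  (hdisj : forall j k, j != k -> sphere_meas (D j `&` D k) = 0%E)
  (hmass : forall j, sphere_meas (D j) = (n%:R^-1)%:E)
  (hdiam : forall j x y, D j x -> D j y ->
             eucl_dist x y <= c / (n%:R `^ (d%:R^-1)))
  (hc : c / (n%:R `^ (d%:R^-1)) < Num.sqrt 2) :
  (jitter_exp [seq D i | i <- enum 'I_n]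
     (fun xs => (frob2 (n%:R^-1 *: ((analysis_matrix d n xs)^T *m analysis_matrix d n xs)
                        - (d.+1)%:R^-1 *: 1%:M))%:E)
   <= (n%:R^-1 - n%:R^-1 * (1 - c ^+ 2 / (2 * n%:R `^ (2 / d%:R))) ^+ 2)%:E)%E.
Proof.
have [s sE] := @sphere_intP R d.
have n0 : n%:R != 0 :> R by rewrite pnatr_eq0 -lt0n.
have w0 : 0 < n%:R^-1 :> R by rewrite invr_gt0 ltr0n.
have DS i : D i `<=` sphere d by exact: partition_subset hcover i.
have cD i : cell n%:R^-1 (D i) by split.
have sD i : s (D i) = (n%:R^-1)%:E := cell_meas sE (cD i).
have sdisj j k : j != k -> s (D j `&` D k) = 0%E.
  by move=> /hdisj <-; rewrite (sphere_measE sE)//; exact: measurableI.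
have sfin i : (s (D i) < +oo)%E by rewrite sD ltry.
pose M i := second_moment s n%:R^-1 (D i).
(* The sampling weight cancels the normalization of the means, leaving the moment of the whole
   sphere. *)
have sumM : n%:R^-1 *: \sum_i M i = d.+1%:R^-1 *: 1%:M.
  rewrite /M /second_moment -scaler_sumr scalerA divff ?invr_neq0// scale1r.
  apply: (sum_moment sE hmeas hcover sdisj sfin).
  under eq_bigr do rewrite sD/=.
  by rewrite sumr_const card_ord -[X in X = _]mulr_natl mulfV.
pose delta := c / n%:R `^ d%:R^-1.
have kappaE : 1 - c ^+ 2 / (2 * n%:R `^ (2 / d%:R)) = 1 - delta ^+ 2 / 2.
  have X0 : n%:R `^ d%:R^-1 != 0 :> R by rewrite gt_eqF ?powR_gt0 ?ltr0n.
  rewrite [2 / d%:R]mulrC powRrM powR_mulrn ?powR_ge0//.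
  by rewrite /delta; field.
have frobM i : (1 - delta ^+ 2 / 2) ^+ 2 <= frob2 (M i).
  (* A cell has positive mass, hence a point; its distance to itself shows that [delta] is
     nonnegative. *)
  have [x Dx] : D i !=set0.
    apply/set0P/eqP => Di0; have := sD i; rewrite Di0 measure0 => -[/esym/eqP].
    by rewrite gt_eqF.
  have delta0 : 0 <= delta.
    by apply: le_trans (hdiam i x x Dx Dx); exact: sqrtr_ge0.
  apply: (frob2_second_moment_ge sE w0 (cD i)).
    (* Here the bound by the square root of 2 enters: it makes the lower bound on inner products
       nonnegative, so that it may be squared. *)
    have : delta ^+ 2 < 2 by rewrite -[2 in ltRHS]sqr_sqrtr// ltr_pXn2r ?nnegrE ?sqrtr_ge0.
    lra.
  move=> y z Dy Dz; rewrite sphere_dot//; try exact: DS Dy; try exact: DS Dz.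
  rewrite lerB// ler_pM2r ?invr_gt0// ler_pXn2r ?nnegrE ?sqrtr_ge0//.
  exact: hdiam Dy Dz.
rewrite (eq_jitter_exp (G := fun xs =>
    (frob2 (- (d.+1%:R^-1 *: 1%:M) + n%:R^-1 *: gram xs))%:E)); last first.
  move=> xs; rewrite size_map size_enum_ord => <-.
  by rewrite gramE addrC.
rewrite (jitter_exp_frob2 sE w0); last first.
  by move=> E /List.in_map_iff[i [<- _]].
(* By [sumM] the bias vanishes and only the sum of the variances remains. *)
rewrite !big_map -enumT !big_enum /= sumM addNr frob20 add0r lee_fin kappaE.
set k2 := (1 - _) ^+ 2 in frobM *.
have le_sum : \sum_i (1 - frob2 (M i)) <= n%:R * (1 - k2).
  apply: le_trans (_ : _ <= \sum_(i < n) (1 - k2)) _.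
    by apply: ler_sum => i _; rewrite lerB.
  by rewrite sumr_const card_ord mulr_natl.
apply: le_trans (ler_wpM2l _ le_sum) _; first by rewrite exprn_ge0// ltW.
by rewrite expr2 mulrA mulfVK// mulrBr mulr1.
Qed.
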